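(* Let $(n,k,r)$ be an admissible triple of parameters, i.e. $n\in\mathbb{N}$, $k\in\{0,\ldots,n\}$, $r\in[0,\infty)$ and $\max\{k,r\}>0$. Then the expectation of an $r$-Lah distributed random variable $\mathrm{Lah}(n,k)_r$ is given by $$\mathbb{E}[\mathrm{Lah}(n,k)_r]=\frac{k(n+2r)}{n-(k-1)}\bigl[H_{n+2r}-H_{k+2r-1}\bigr]+r\bigl[H_{n+2r-1}-H_{k+2r-1}\bigr]$$ $$=\frac{k+\bigl[k(n+r)+r(n+1)\bigr]\cdot\bigl[H_{n+2r-1}-H_{k+2r-1}\bigr]}{n-(k-1)}.$$
   Context: $\mathbb{N}=\{1,2,\ldots\}$, $\mathbb{N}_0=\mathbb{N}\cup\{0\}$. Let $\genfrac{[}{]}{0pt}{}{n}{k}$ and $\genfrac{\{}{\}}{0pt}{}{n}{k}$ be the (unsigned) Stirling numbers of the first kind (number of permutations of $\{1,\dots,n\}$ with exactly $k$ cycles) and of the second kind (number of partitions of $\{1,\dots,n\}$ into $k$ non-empty subsets). For $n\in\mathbb{N}_0$, $k\in\{0,\ldots,n\}$ and $r\in\mathbb{R}$ the $r$-Stirling numbers are defined (with $0^0=1$) by $$\genfrac{[}{]}{0pt}{}{n}{k}_r=\sum_{j=k}^n\genfrac{[}{]}{0pt}{}{n}{j}\binom{j}{k}r^{j-k},\qquad \genfrac{\{}{\}}{0pt}{}{n}{k}_r=\sum_{j=k}^n\binom{n}{j}\genfrac{\{}{\}}{0pt}{}{j}{k}r^{n-j}.$$ The $r$-Lah number is $L(n,k)_r=\sum_{j=k}^n\genfrac{[}{]}{0pt}{}{n}{j}_r\genfrac{\{}{\}}{0pt}{}{j}{k}_r$.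 For an admissible triple $(n,k,r)$, $\mathrm{Lah}(n,k)_r$ denotes a random variable with the $r$-Lah distribution $$\mathbb{P}[\mathrm{Lah}(n,k)_r=j]=\frac{1}{L(n,k)_r}\genfrac{[}{]}{0pt}{}{n}{j}_r\genfrac{\{}{\}}{0pt}{}{j}{k}_r,\qquad j\in\{k,k+1,\ldots,n\}.$$ Differences of harmonic numbers with real arguments: for integer $m\in\mathbb{N}_0$ and real $\alpha>-1$, $H_{\alpha+m}-H_\alpha:=\sum_{i=1}^{m}\frac{1}{\alpha+i}$. *)

(* Defs.v *)
From HB Require Import structures.
From mathcomp Require Import all_boot all_order all_algebra all_fingroup.
From mathcomp Require Import all_classical all_reals all_analysis.

Set Implicit Arguments.
Unset Strict Implicit.
Unset Printing Implicit Defensive.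

Import Order.TTheory GRing.Theory Num.Theory.

Local Open Scope ring_scope.

(* porbits s is the set of cycles of s, fixed points included. *)
Definition stirling1 (n k : nat) : nat :=
  #|[pred s : {perm 'I_n} | #|porbits s| == k]|.

Definition stirling2 (n k : nat) : nat :=
  #|[pred Q : {set {set 'I_n}} | finset.partition Q [set: 'I_n]%SET && (#|Q| == k)]|.

Definition rstirling1 (R : realType) (r : R) (n k : nat) : R :=
  \sum_(k <= j < n.+1) (stirling1 n j)%:R * 'C(j, k)%:R * r ^+ (j - k).

Definition rstirling2 (R : realType) (r : R) (n k : nat) : R :=
  \sum_(k <= j < n.+1) 'C(n, j)%:R * (stirling2 j k)%:R * r ^+ (n - j).

Definition rLah (R : realType) (r : R) (n k : nat) : R :=
  \sum_(k <= j < n.+1) rstirling1 r n j * rstirling2 r j k.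

Definition admissible (R : realType) (n k : nat) (r : R) : Prop :=
  [/\ (0 < n)%N, (k <= n)%N, 0 <= r & 0 < Num.max k%:R r].

(* No condition outside {k, ..., n}: the prescribed masses already sum to 1. *)
Definition rLah_distributed (d : measure_display) (T : measurableType d)
    (R : realType) (P : probability T R) (X : {RV P >-> R})
    (n k : nat) (r : R) : Prop :=
  forall j : nat, (k <= j <= n)%N ->
    distribution P X [set j%:R]%classic =
    ((rLah r n k)^-1 * (rstirling1 r n j * rstirling2 r j k))%:E.

(* H_(alpha + m) - H_alpha, meaningful for alpha > -1. *)
Definition harmonic_diff (R : realType) (alpha : R) (m : nat) : R :=
  \sum_(1 <= i < m.+1) (alpha + i%:R)^-1.

(* Main.v *)
Require Import Defs.
From HB Require Import structures.
From mathcomp Require Import all_boot all_order all_algebra all_fingroup.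
From mathcomp Require Import all_classical all_reals all_analysis.
From mathcomp Require Import measurable_realfun.
From mathcomp Require Import ring lra.

(** Both kinds of r-Stirling numbers satisfy Pascal-type recurrences, inherited
    from those of the ordinary Stirling numbers.  Combining them, the r-Lah
    numbers [L n k] and the unnormalised first moments
    [M n k = \sum_j j [n, j]_r {j, k}_r] satisfy
      [L (n+1) (k+1) = (n + k + 1 + 2r) L n (k+1) + L n k],
      [M (n+1) (k+1) = (n + k + 1 + 2r) M n (k+1) + (k + 1 + r) L n (k+1)
                       + M n k + L n k].
    Induction on [n] then gives
    [L n k = C(n, k) (k+2r)(k+1+2r)...(n-1+2r)] and [M n k = L n k * mean]
    with the claimed mean. *)

Set Implicit Arguments.
Unset Strict Implicit.
Unset Printing Implicit Defensive.

Import Order.TTheory GRing.Theory Num.Theory.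

Local Open Scope ring_scope.

Section StirlingNumbers.
(* MathComp-Analysis shadows many names of [fintype] and [finset]. *)
Import mathcomp.boot.fintype mathcomp.boot.finset.

(** * Stirling numbers of the first kind: counting permutations by cycles *)

(** The lifted permutation fixes [i] and acts as [s] on the other points, so its cycles are [{i}]
    and the images under [lift i] of the cycles of [s]. *)
Lemma porbits_lift_perm n (i : 'I_n.+1) (s : {perm 'I_n}) :
  #|porbits (lift_perm i i s)| = #|porbits s|.+1.
Proof.
set t := lift_perm i i s.
have tX m j : (t ^+ m)%g (lift i j) = lift i ((s ^+ m)%g j).
  by elim: m => [|m IH]; rewrite ?perm1 // !expgSr !permM IH lift_perm_lift.
have tXi m : (t ^+ m)%g i = i.
  by elim: m => [|m IH]; rewrite ?perm1 // expgSr permM IH lift_perm_id.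
have porbi : porbit t i = [set i]%SET.
  apply/setP=> x; rewrite inE; apply/porbitP/eqP => [[m ->]|->]; first exact: tXi.
  by exists 0%N; rewrite perm1.
have porbl j : porbit t (lift i j) = lift i @: porbit s j.
  apply/setP=> x; apply/porbitP/imsetP => [[m ->]|[_ /porbitP[m ->] ->]].
    by exists ((s ^+ m)%g j); rewrite ?mem_porbit ?tX.
  by exists m; rewrite tX.
have -> : porbits t = ([set i] |: ((fun B : {set 'I_n} => lift i @: B) @: porbits s))%SET.
  apply/setP=> B; rewrite !inE; apply/imsetP/orP => [[x _ ->]|].
    case: (unliftP i x) => [j|] ->; last by left; rewrite porbi.
    by right; rewrite porbl; apply/imsetP; exists (porbit s j); rewrite ?imset_f.
  case=> [/eqP->|/imsetP[_ /imsetP[j _ ->] ->]]; first by exists i.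
  by exists (lift i j).
rewrite cardsU1 card_imset; last exact: imset_inj (@lift_inj _ i).
case: imsetP => // -[B _ /setP/(_ i)]; rewrite inE eqxx => /esym/imsetP[j _ /eqP].
by rewrite (negPf (neq_lift i j)).
Qed.

(* [insert_perm (i, s)] inserts the new point [ord_max] into the cycle of [i],
   or makes it a fixed point when [i = ord_max]. *)
Definition insert_perm n (p : 'I_n.+1 * {perm 'I_n}) : {perm 'I_n.+1} :=
  (tperm ord_max p.1 * lift_perm ord_max ord_max p.2)%g.

(** By cardinality, injectivity suffices. The first component is recovered as the point sent to
    [ord_max]; cancelling the transposition then recovers the second. *)
Lemma insert_perm_bij n : bijective (@insert_perm n).
Proof.
apply: inj_card_bij; last first.
  by rewrite card_prod !card_Sn card_ord factS.
case=> [i s] [j t]; rewrite /insert_perm /= => E.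
have ij : i = j.
  apply: (@perm_inj _ (tperm ord_max i * lift_perm ord_max ord_max s)%g).
  by rewrite {2}E !permM !tpermR !lift_perm_id.
move: E; rewrite {}ij => /mulgI E; congr pair; apply/permP=> x.
by apply: (@lift_inj _ ord_max); rewrite -!(lift_perm_lift ord_max) E.
Qed.

(** A transposition of points in two different cycles merges these cycles. Here [ord_max] is alone
    in its cycle, so for [i != ord_max] the merge undoes the extra cycle created by the lift. *)
Lemma porbits_insert_perm n (p : 'I_n.+1 * {perm 'I_n}) :
  #|porbits (insert_perm p)| = ((p.1 == ord_max) + #|porbits p.2|)%N.
Proof.
case: p => i s; rewrite /insert_perm /=.
have [->|ni] := eqVneq i ord_max.
  by rewrite tperm1 mul1g porbits_lift_perm.
have := porbits_mul_tperm (lift_perm ord_max ord_max s) ord_max i.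
rewrite /= porbits_lift_perm eq_sym ni porbit_sym.
have -> : i \in porbit (lift_perm ord_max ord_max s) ord_max = false.
  apply/negP => /porbitP[m E]; case/eqP: ni; rewrite E.
  elim: m {E} => [|m IH]; first by rewrite perm1.
  by rewrite expgSr permM IH lift_perm_id.
by rewrite /= addn1 addn2 => -[].
Qed.

Lemma stirling1_sum n k :
  stirling1 n k = (\sum_(s : {perm 'I_n}) (#|porbits s| == k))%N.
Proof.
by rewrite /stirling1 -sum1_card big_mkcond; apply: eq_bigr => s _; rewrite inE; case: eqP.
Qed.

(** Fibres the permutations over the first component of [insert_perm]: the [n] values other than
    [ord_max] keep the number of cycles, while [ord_max] adds one. Keeping the last term as a sum
    covers both [k = 0] and successors. *)
Lemma stirling1Sn n k :
  stirling1 n.+1 k =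
  (n * stirling1 n k + \sum_(s : {perm 'I_n}) (#|porbits s|.+1 == k))%N.
Proof.
rewrite stirling1_sum (reindex (@insert_perm n)) /=; last exact: onW_bij (insert_perm_bij n).
rewrite -(pair_bigA _ (fun i s => (#|porbits (insert_perm (i, s))| == k) : nat)) /=.
rewrite (bigD1 ord_max) //= addnC; congr addn; last first.
  by apply: eq_bigr => s _; rewrite porbits_insert_perm /= eqxx.
rewrite (eq_bigr (fun=> stirling1 n k)) => [|i ni].
  rewrite sum_nat_const; congr muln.
  by rewrite cardC1 card_ord.
by rewrite stirling1_sum; apply: eq_bigr => s _; rewrite porbits_insert_perm /= (negPf ni).
Qed.

Lemma stirling1S0 n : stirling1 n.+1 0 = (n * stirling1 n 0)%N.
Proof. by rewrite stirling1Sn big1 ?addn0. Qed.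

Lemma stirling1SS n k :
  stirling1 n.+1 k.+1 = (n * stirling1 n k.+1 + stirling1 n k)%N.
Proof. by rewrite stirling1Sn (stirling1_sum n k). Qed.

Lemma stirling10 k : stirling1 0 k = (k == 0)%N.
Proof.
rewrite stirling1_sum (bigD1 1%g) //= big1 => [|s]; last first.
  by rewrite (_ : s = 1%g) ?eqxx //; apply/permP=> -[].
rewrite addn0 (_ : porbits _ = set0)%SET ?cards0 1?eq_sym //.
by apply/setP=> B; rewrite inE; apply/imsetP=> -[[]].
Qed.

(** * Stirling numbers of the second kind: counting set partitions *)

(** Partitions of an arbitrary finite set rather than of a full ordinal type, so that one point can
    be removed. *)
Definition kpartitions (T : finType) (D : {set T}) k : {set {set {set T}}} :=
  [set Q : {set {set T}} | finset.partition Q D & #|Q| == k]%SET.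

Lemma card_kpartitions_imset (T T' : finType) (f : T -> T') (D : {set T}) k :
  injective f -> #|kpartitions (f @: D) k| = #|kpartitions D k|.
Proof.
move=> injf; pose F (Q : {set {set T}}) := [set f @: (B : {set T}) | B in Q]%SET.
have injF : injective F by apply: imset_inj; apply: imset_inj.
rewrite -(card_imset _ injF); apply: eq_card => Q'.
apply/idP/imsetP => [|[Q QP ->]]; last first.
  by move: QP; rewrite !inE imset_partition // card_imset //; apply: imset_inj.
rewrite inE => /andP[pQ' cQ'].
(* Blocks of [Q'] lie in the image of [f], so taking preimages of blocks inverts [F]. *)
pose Q := [set f @^-1: (B : {set T'}) | B in Q']%SET.
suff defQ' : F Q = Q'.
  exists Q => //; rewrite inE -(imset_partition Q D injf) -/(F Q) defQ' pQ' /=.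
  by rewrite -(card_imset (mem Q) (imset_inj injf)) -/(F Q) defQ'.
rewrite /F /Q -imset_comp -[RHS]imset_id; apply: eq_in_imset => B BQ' /=.
apply/setP=> y; apply/imsetP/idP => [[x]|yB]; first by rewrite inE => ? ->.
have /imsetP[x xD yE] := subsetP (partitionS pQ' BQ') y yB.
by exists x; rewrite // inE -yE.
Qed.

Lemma card_kpartitions_stirling2 (T : finType) (D : {set T}) k :
  #|kpartitions D k| = stirling2 #|D| k.
Proof.
have -> : D = [set enum_val i | i in [set: 'I_#|D|]]%SET.
  apply/setP=> x; apply/idP/imsetP => [xD|[i _ ->]]; last exact: enum_valP.
  by exists (enum_rank_in xD x); rewrite ?inE ?enum_rankK_in.
rewrite card_kpartitions_imset; last exact: enum_val_inj.
by rewrite card_imset ?cardsT ?card_ord; [rewrite /stirling2 cardsE|exact: enum_val_inj].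
Qed.

(** If [{x}] is a block, deleting it leaves [k] blocks partitioning [D]. Otherwise deleting [x]
    leaves [k + 1] blocks, and [x] may have come from any of them. *)
Lemma card_kpartitionsU1 (T : finType) (D : {set T}) (x : T) k : x \notin D ->
  #|kpartitions (x |: D)%SET k.+1| =
  (#|kpartitions D k| + k.+1 * #|kpartitions D k.+1|)%N.
Proof.
move=> xD; pose S : {set {set {set T}}} := [set Q : {set {set T}} | [set x] \in Q]%SET.
have xQ Q B : finset.partition Q D -> B \in Q -> x \notin B.
  by move=> pQ BQ; apply: contraNN xD; apply: subsetP (partitionS pQ BQ) x.
rewrite -(cardsID S); congr addn.
  have -> : (kpartitions (x |: D) k.+1 :&: S =
             [set ([set x] |: Q) | Q : {set {set T}} in kpartitions D k])%SET.
    apply/setP=> Q; rewrite !inE; apply/andP/imsetP => [[/andP[pQ cQ] xinQ]|[Q']].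
      exists (Q :\ [set x])%SET; last by rewrite setD1K.
      rewrite inE; have := partitionD1 pQ xinQ; rewrite setU1K // => ->.
      by move: cQ; rewrite (cardsD1 [set x]%SET Q) xinQ.
    rewrite inE => /andP[pQ cQ] ->; rewrite partitionU1 //.
    - rewrite cardsU1 (eqP cQ) setU11.
      case: (boolP (_ \in Q')) => [/(xQ _ _ pQ)|_]; first by rewrite inE eqxx.
      by rewrite add1n eqxx.
    - by apply/set0Pn; exists x; rewrite inE.
    - by rewrite disjoints1.
  rewrite card_in_imset // => Q Q'; rewrite !inE => /andP[pQ _] /andP[pQ' _] E.
  have nQ P : finset.partition P D -> ([set x] \notin P)%SET.
    by move=> pP; apply/negP => /(xQ _ _ pP); rewrite inE eqxx.
  by rewrite -(setU1K (nQ _ pQ)) E setU1K ?nQ.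
(* A partition in which [x] is not alone arises from a unique pair of a
   partition of [D] and the block to which [x] is added. *)
pose Z := [set p : {set {set T}} * {set T} | p.1 \in kpartitions D k.+1 & p.2 \in p.1]%SET.
pose g (p : {set {set T}} * {set T}) := ((x |: p.2) |: (p.1 :\ p.2))%SET.
have -> : (kpartitions (x |: D) k.+1 :\: S = g @: Z)%SET.
  apply/setP=> Q; rewrite !inE; apply/andP/imsetP => [[xnQ /andP[pQ cQ]]|].
    (* The preimage of [Q] under [g] replaces the block [b] of [x] by [B], which is non-empty
       because [{x}] is not a block. *)
    pose b := pblock Q x; pose B := (b :\ x)%SET.
    have xcov : x \in cover Q by rewrite (cover_partition pQ) setU11.
    have bQ : b \in Q by rewrite pblock_mem.
    have xb : x \in b by rewrite mem_pblock.
    have B0 : B != set0%SET.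
      apply: contraNN xnQ => /eqP B0; suff <- : b = [set x]%SET by [].
      by rewrite -(setD1K xb) -/B B0 setU0.
    have dis : [disjoint B & (x |: D) :\: b]%SET.
      apply/pred0P=> y /=; rewrite !inE.
      by case: (y \in b); rewrite ?andbF.
    have BnQ : B \notin (Q :\ b)%SET.
      apply/negP => BQ; have /set0Pn[y yB] := B0.
      have yD := subsetP (partitionS (partitionD1 pQ bQ) BQ) y yB.
      by move/pred0P: dis => /(_ y); rewrite /= yB yD.
    exists ((B |: (Q :\ b))%SET, B); last by rewrite /g /= setU1K // setD1K // setD1K.
    rewrite inE /= setU11 andbT inE cardsU1 BnQ.
    move: cQ; rewrite (cardsD1 b Q) bQ => ->; rewrite andbT.
    have := partitionU1 (partitionD1 pQ bQ) B0 dis.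
    suff -> : (B :|: ((x |: D) :\: b) = D)%SET by [].
    have bD := partitionS pQ bQ.
    apply/setP=> y; rewrite !inE; case: (eqVneq y x) => [->|yx] /=.
      by rewrite xb (negPf xD).
    case: (boolP (y \in b)) => //= yb.
    by have := subsetP bD y yb; rewrite !inE (negPf yx) /= => ->.
  case=> -[Q' B]; rewrite inE /= inE => /andP[/andP[pQ cQ] BQ] ->; rewrite /g /=.
  have xB := xQ _ _ pQ BQ.
  have dis : [disjoint (x |: B) & (D :\: B)]%SET.
    apply/pred0P=> y /=; rewrite !inE; case: eqVneq => [->|_] /=.
      by rewrite (negPf xD) andbF.
    by case: (y \in B).
  have xBn : (x |: B \notin Q' :\ B)%SET.
    by rewrite !inE; apply/negP => /andP[_ /(xQ _ _ pQ)]; rewrite setU11.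
  split.
    rewrite !inE !negb_or; apply/andP; split.
      apply: contraNN (partition_neq0 pQ BQ) => /eqP E.
      by rewrite -(setU1K xB) -E setDv.
    by rewrite negb_and negbK; apply/orP; right; apply/negP => /(xQ _ _ pQ); rewrite inE eqxx.
  apply/andP; split.
    have := partitionU1 (partitionD1 pQ BQ) _ dis.
    suff -> : ((x |: B) :|: (D :\: B) = x |: D)%SET.
      by apply; apply/set0Pn; exists x; rewrite setU11.
    rewrite -setUA; congr setU; apply/setP=> y; rewrite !inE.
    case: (boolP (y \in B)) => //= yB.
    by rewrite (subsetP (partitionS pQ BQ) y yB).
  by rewrite cardsU1 xBn -(eqP cQ) (cardsD1 B Q') BQ.
rewrite card_in_imset => [|[Q B] [Q' B']]; last first.
  rewrite !inE /g /= => /andP[/andP[pQ _] BQ] /andP[/andP[pQ' _] BQ'] E.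
  have xB := xQ _ _ pQ BQ; have xB' := xQ _ _ pQ' BQ'.
  have nin P C C' : finset.partition P D -> (x |: C \notin P :\ C')%SET.
    by move=> pP; rewrite !inE; apply/negP => /andP[_ /(xQ _ _ pP)]; rewrite setU11.
  (* The block containing [x] is unique in the image, so it determines [B]. *)
  have BB' : B = B'.
    have : (x |: B \in (x |: B') |: (Q' :\ B'))%SET by rewrite -E setU11.
    rewrite in_setU1 (negPf (nin _ _ _ pQ')) orbF => /eqP EB.
    by rewrite -(setU1K xB) EB setU1K.
  subst B'; congr pair; rewrite -(setD1K BQ) -(setD1K BQ'); congr setU.
  by rewrite -(setU1K (nin Q B B pQ)) E setU1K // nin.
rewrite -sum1dep_card.
rewrite -(pair_big_dep (mem (kpartitions D k.+1))
  (fun (Q : {set {set T}}) B => B \in Q) (fun _ _ => 1%N)) /=.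
rewrite (eq_bigr (fun=> k.+1)); first by rewrite sum_nat_const mulnC.
by move=> Q; rewrite inE sum1_card => /andP[_ /eqP].
Qed.

Lemma stirling2SS n k :
  stirling2 n.+1 k.+1 = (stirling2 n k + k.+1 * stirling2 n k.+1)%N.
Proof.
pose D : {set 'I_n.+1} := [set~ ord0]%SET.
have cD : #|D| = n by rewrite cardsC1 card_ord.
have := @card_kpartitionsU1 _ D ord0 k.
rewrite !card_kpartitions_stirling2 cardsU1 cD !inE eqxx /= add1n; exact.
Qed.

Lemma stirling20n k : stirling2 0 k = (k == 0)%N.
Proof.
have := card_kpartitions_stirling2 (@set0 'I_0)%SET k; rewrite cards0 => <-.
case: k => [|k].
  suff -> : kpartitions (@set0 'I_0)%SET 0 = [set set0]%SET by rewrite cards1.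
  apply/setP=> Q; rewrite !inE partition_set0.
  by case: eqP => // ->; rewrite cards0.
apply/eqP; rewrite cards_eq0; apply/eqP/setP=> Q.
by rewrite !inE partition_set0; case: eqP => // ->; rewrite cards0.
Qed.

Lemma stirling2S0 n : stirling2 n.+1 0 = 0%N.
Proof.
have := card_kpartitions_stirling2 [set: 'I_n.+1]%SET 0; rewrite cardsT card_ord => <-.
apply/eqP; rewrite cards_eq0; apply/eqP/setP=> Q; rewrite !inE cards_eq0.
apply/negP => /andP[pQ /eqP Q0]; move: pQ; rewrite Q0 => /cover_partition/setP/(_ ord0).
by rewrite /cover big_set0 !inE.
Qed.

End StirlingNumbers.

(** * Vanishing above the diagonal and summation tools *)

Lemma stirling1_small n k : (n < k)%N -> stirling1 n k = 0%N.
Proof.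
elim: n k => [|n IH] [|k] // nk; first by rewrite stirling10.
by rewrite stirling1SS !IH ?muln0 //; exact: ltnW.
Qed.

Lemma stirling2_small n k : (n < k)%N -> stirling2 n k = 0%N.
Proof.
elim: n k => [|n IH] [|k] // nk; first by rewrite stirling20n.
by rewrite stirling2SS !IH ?muln0 //; exact: ltnW.
Qed.

(** Transfers a Pascal-type recurrence from coefficients to weighted sums. It serves three times:
    with [u = n] for [stirling1], [u = 1] for binomials and [u = n + r] for [rstirling1]. *)
Lemma triangular_sum (R : comNzRingType) (A A' a : nat -> R) (u : R) n :
  A n.+1 = 0 -> A' 0%N = u * A 0%N ->
  (forall j, A' j.+1 = u * A j.+1 + A j) ->
  \sum_(j < n.+2) A' j * a j =
  u * (\sum_(j < n.+1) A j * a j) + \sum_(j < n.+1) A j * a j.+1.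
Proof.
move=> An A0 AS; rewrite big_ord_recl /= A0.
under eq_bigr do rewrite /bump /= add1n AS mulrDl.
rewrite big_split /= addrA; congr (_ + _).
transitivity (u * \sum_(j < n.+2) A j * a j).
  rewrite [in RHS]big_ord_recl mulrDr mulrA mulr_sumr; congr (_ + _).
  by apply: eq_bigr => j _; rewrite mulrA.
by rewrite big_ord_recr /= An mul0r addr0.
Qed.

Lemma sum_nat_ord_widen (V : nmodType) (F : nat -> V) k n :
  (forall j, (j < k)%N -> F j = 0) ->
  \sum_(k <= j < n) F j = \sum_(j < n) F j.
Proof.
move=> F0; rewrite -(big_mkord xpredT F).
have [kn|nk] := leqP k n; last first.
  rewrite [LHS]big_geq ?(ltnW nk) // big_nat big1 // => j /andP[_ jn].
  by rewrite F0 // (ltn_trans jn).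
rewrite [RHS](@big_cat_nat _ _ _ k) //= [X in _ = X + _]big_nat.
by rewrite [X in _ = X + _]big1 ?add0r // => j /andP[_ /F0].
Qed.

(** * Recurrences of the r-Stirling numbers *)

Section RStirling.
Variables (R : realType) (r : R).

Lemma rstirling1E n k :
  rstirling1 r n k = \sum_(j < n.+1) (stirling1 n j)%:R * ('C(j, k)%:R * r ^+ (j - k)).
Proof.
rewrite /rstirling1 sum_nat_ord_widen => [|j jk]; last by rewrite bin_small // mulr0 mul0r.
by apply: eq_bigr => j _; rewrite mulrA.
Qed.

Lemma rstirling2E n k :
  rstirling2 r n k = \sum_(j < n.+1) 'C(n, j)%:R * ((stirling2 j k)%:R * r ^+ (n - j)).
Proof.
rewrite /rstirling2 sum_nat_ord_widen => [|j jk]; last by rewrite stirling2_small // mulr0 mul0r.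
by apply: eq_bigr => j _; rewrite mulrA.
Qed.

Lemma rstirling1_small n k : (n < k)%N -> rstirling1 r n k = 0.
Proof. by move=> nk; rewrite /rstirling1 big_geq. Qed.

Lemma rstirling2_small n k : (n < k)%N -> rstirling2 r n k = 0.
Proof. by move=> nk; rewrite /rstirling2 big_geq. Qed.

Lemma rstirling10n k : rstirling1 r 0 k = (k == 0)%:R.
Proof.
by rewrite rstirling1E big_ord1 stirling10 mul1r sub0n mulr1 bin0n.
Qed.

Lemma rstirling20n k : rstirling2 r 0 k = (k == 0)%:R.
Proof. by rewrite rstirling2E big_ord1 stirling20n bin0 mul1r mulr1. Qed.

Lemma stirling1_triangular_sum n (a : nat -> R) :
  \sum_(j < n.+2) (stirling1 n.+1 j)%:R * a j =
  n%:R * (\sum_(j < n.+1) (stirling1 n j)%:R * a j)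
  + \sum_(j < n.+1) (stirling1 n j)%:R * a j.+1.
Proof.
apply: (@triangular_sum _ (fun j => (stirling1 n j)%:R) (fun j => (stirling1 n.+1 j)%:R)).
- by rewrite stirling1_small.
- by rewrite stirling1S0 natrM.
- by move=> j; rewrite stirling1SS natrD natrM.
Qed.

Lemma rstirling1S0 n : rstirling1 r n.+1 0 = (n%:R + r) * rstirling1 r n 0.
Proof.
rewrite !rstirling1E (stirling1_triangular_sum n (fun j => 'C(j, 0)%:R * r ^+ (j - 0))).
rewrite mulrDl; congr (_ + _).
rewrite mulr_sumr; apply: eq_bigr => j _.
by rewrite !bin0 !subn0 exprS; ring.
Qed.

Lemma rstirling1SS n k :
  rstirling1 r n.+1 k.+1 = (n%:R + r) * rstirling1 r n k.+1 + rstirling1 r n k.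
Proof.
rewrite !rstirling1E (stirling1_triangular_sum n (fun j => 'C(j, k.+1)%:R * r ^+ (j - k.+1))).
rewrite mulrDl -addrA; congr (_ + _).
rewrite mulr_sumr -big_split /=; apply: eq_bigr => j _.
rewrite binS natrD subSS.
(* For [j <= k] the truncated exponent [j - k.+1] breaks the relation between powers of [r], but
   there ['C(j, k.+1)] vanishes. *)
have [jk|kj] := leqP j k; first by rewrite (bin_small (n := j) (m := k.+1)) //; ring.
by rewrite -(subnSK kj) exprS; ring.
Qed.

Lemma bin_triangular_sum n (a : nat -> R) :
  \sum_(j < n.+2) 'C(n.+1, j)%:R * a j =
  (\sum_(j < n.+1) 'C(n, j)%:R * a j) + \sum_(j < n.+1) 'C(n, j)%:R * a j.+1.
Proof.
rewrite (@triangular_sum _ (fun j => 'C(n, j)%:R) (fun j => 'C(n.+1, j)%:R) a 1) ?mul1r //.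
- by rewrite bin_small.
- by rewrite !bin0.
- by move=> j; rewrite binS natrD mul1r.
Qed.

Lemma rstirling2S0 n : rstirling2 r n.+1 0 = r * rstirling2 r n 0.
Proof.
rewrite !rstirling2E (bin_triangular_sum n (fun j => (stirling2 j 0)%:R * r ^+ (n.+1 - j))).
rewrite mulr_sumr [X in _ + X]big1 ?addr0.
  by apply: eq_bigr => j _; rewrite (subSn (leq_ord j)) exprS; ring.
by move=> j _; rewrite stirling2S0 mul0r mulr0.
Qed.

Lemma rstirling2SS n k :
  rstirling2 r n.+1 k.+1 = (k.+1%:R + r) * rstirling2 r n k.+1 + rstirling2 r n k.
Proof.
rewrite !rstirling2E (bin_triangular_sum n (fun j => (stirling2 j k.+1)%:R * r ^+ (n.+1 - j))).
rewrite mulr_sumr -!big_split /=.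
apply: eq_bigr => j _; rewrite stirling2SS natrD natrM subSS (subSn (leq_ord j)) exprS.
ring.
Qed.

(** * Recurrences of the r-Lah numbers and their first moments *)

Definition rLah_moment n k : R :=
  \sum_(j < n.+1) rstirling1 r n j * (j%:R * rstirling2 r j k).

Lemma rLahE n k : rLah r n k = \sum_(j < n.+1) rstirling1 r n j * rstirling2 r j k.
Proof.
by rewrite /rLah sum_nat_ord_widen // => j jk; rewrite rstirling2_small // mulr0.
Qed.

Lemma rstirling1_triangular_sum n (a : nat -> R) :
  \sum_(j < n.+2) rstirling1 r n.+1 j * a j =
  (n%:R + r) * (\sum_(j < n.+1) rstirling1 r n j * a j)
  + \sum_(j < n.+1) rstirling1 r n j * a j.+1.
Proof.
apply: triangular_sum; first exact: rstirling1_small.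
- exact: rstirling1S0.
- exact: rstirling1SS.
Qed.

Lemma rLah0n k : rLah r 0 k = (k == 0)%:R.
Proof. by rewrite rLahE big_ord1 rstirling10n mul1r rstirling20n. Qed.

Lemma rLahS0 n : rLah r n.+1 0 = (n%:R + 2 * r) * rLah r n 0.
Proof.
rewrite !rLahE (rstirling1_triangular_sum n (fun j => rstirling2 r j 0)).
under [X in _ + X]eq_bigr do rewrite rstirling2S0 mulrCA.
by rewrite -mulr_sumr; ring.
Qed.

(** Each of the two r-Stirling recurrences contributes one [r], hence [2 * r]. *)
Lemma rLahSS n k :
  rLah r n.+1 k.+1 = (n%:R + k.+1%:R + 2 * r) * rLah r n k.+1 + rLah r n k.
Proof.
rewrite !rLahE (rstirling1_triangular_sum n (fun j => rstirling2 r j k.+1)).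
under [X in _ + X]eq_bigr do rewrite rstirling2SS mulrDr mulrCA.
by rewrite big_split /= -mulr_sumr; ring.
Qed.

Lemma rLah_moment0n k : rLah_moment 0 k = 0.
Proof. by rewrite /rLah_moment big_ord1 mul0r mulr0. Qed.

Lemma rLah_momentS0 n :
  rLah_moment n.+1 0 = (n%:R + 2 * r) * rLah_moment n 0 + r * rLah r n 0.
Proof.
rewrite rLahE /rLah_moment (rstirling1_triangular_sum n (fun j => j%:R * rstirling2 r j 0)).
have -> : \sum_(j < n.+1) rstirling1 r n j * (j.+1%:R * rstirling2 r j.+1 0) =
    r * (\sum_(j < n.+1) rstirling1 r n j * (j%:R * rstirling2 r j 0))
    + r * \sum_(j < n.+1) rstirling1 r n j * rstirling2 r j 0.
  rewrite !mulr_sumr -big_split; apply: eq_bigr => j _ /=.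
  by rewrite rstirling2S0 -natr1; ring.
by ring.
Qed.

(** The shifted weight [j.+1] splits as [j + 1]; the summand 1 produces the additional r-Lah
    terms. *)
Lemma rLah_momentSS n k :
  rLah_moment n.+1 k.+1 =
  (n%:R + k.+1%:R + 2 * r) * rLah_moment n k.+1 + (k.+1%:R + r) * rLah r n k.+1
  + rLah_moment n k + rLah r n k.
Proof.
rewrite !rLahE /rLah_moment (rstirling1_triangular_sum n (fun j => j%:R * rstirling2 r j k.+1)).
have -> : \sum_(j < n.+1) rstirling1 r n j * (j.+1%:R * rstirling2 r j.+1 k.+1) =
    (k.+1%:R + r) * (\sum_(j < n.+1) rstirling1 r n j * (j%:R * rstirling2 r j k.+1))
    + (k.+1%:R + r) * (\sum_(j < n.+1) rstirling1 r n j * rstirling2 r j k.+1)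
    + (\sum_(j < n.+1) rstirling1 r n j * (j%:R * rstirling2 r j k))
    + \sum_(j < n.+1) rstirling1 r n j * rstirling2 r j k.
  rewrite !mulr_sumr -!big_split; apply: eq_bigr => j _ /=.
  by rewrite rstirling2SS -natr1; ring.
by ring.
Qed.

Lemma rLah_small n k : (n < k)%N -> rLah r n k = 0.
Proof. by move=> nk; rewrite /rLah big_geq. Qed.

Lemma rLah_moment_small n k : (n < k)%N -> rLah_moment n k = 0.
Proof.
move=> nk; rewrite /rLah_moment big1 // => j _.
by rewrite rstirling2_small ?mulr0 // (leq_ltn_trans _ nk) // -ltnS.
Qed.

(** * Closed form of the r-Lah numbers *)

(** The rising factorial of [k + 2r] with [m] factors. *)
Definition shifted_rising k m : R := \prod_(i < m) (k%:R + 2 * r + i%:R).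

Lemma shifted_rising_recl k m :
  shifted_rising k m.+1 = (k%:R + 2 * r) * shifted_rising k.+1 m.
Proof.
rewrite /shifted_rising big_ord_recl addr0; congr (_ * _).
by apply: eq_bigr => i _; rewrite lift0 -natr1 -[k.+1%:R]natr1; ring.
Qed.

Lemma shifted_rising_recr k m :
  shifted_rising k m.+1 = shifted_rising k m * (k%:R + 2 * r + m%:R).
Proof. by rewrite /shifted_rising big_ord_recr. Qed.

Lemma rLah_closed n k :
  rLah r n k = 'C(n, k)%:R * shifted_rising k (n - k).
Proof.
elim: n k => [|n IH] [|k].
- by rewrite rLah0n /shifted_rising big_ord0 mulr1.
- by rewrite rLah0n /= mul0r.
- by rewrite rLahS0 IH !bin0 !subn0 shifted_rising_recr; ring.
have [nk|kn|nk] := ltngtP n k; last subst k.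
- by rewrite !rLah_small ?bin_small ?mul0r // ltnS ltnW.
- rewrite rLahSS !IH subSS binS natrD -(subnSK kn).
  move: (n - k.+1)%N (subnKC kn) => m mE.
  (* After the common rising factorial from [k.+1] is exposed, the absorption identity
     [(k+1) C(n, k+1) = (n-k) C(n, k)] is the only relation needed between the two binomials. *)
  have := mul_bin_left n k; rewrite -[(n - k)%N](subnSK kn) -mE addKn.
  move=> /(congr1 (fun x => x%:R : R)); rewrite !natrM.
  rewrite shifted_rising_recl shifted_rising_recr.
  move: ('C(_, _)%:R) ('C(_, _)%:R) => b c E.
  rewrite natrD -!natr1 in E *.
  have Ec : k%:R * c = (m%:R + 1) * b - c by rewrite -E; ring.
  by ring: Ec.
by rewrite rLahSS !IH subnn subSS !binn bin_small // subnn /shifted_rising !big_ord0; ring.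
Qed.

End RStirling.

(** * Closed form of the first moment *)

Section Moment.
Variables (R : realType) (r : R).

Lemma harmonic_diff_recr (a : R) m :
  harmonic_diff a m.+1 = harmonic_diff a m + (a + m.+1%:R)^-1.
Proof. by rewrite /harmonic_diff big_nat_recr. Qed.

Lemma harmonic_diff_recl (a : R) m :
  harmonic_diff a m.+1 = (a + 1)^-1 + harmonic_diff (a + 1) m.
Proof.
rewrite /harmonic_diff big_nat_recl //; congr (_ + _).
by apply: eq_bigr => i _; rewrite -natr1 -addrA [1 + _]addrC.
Qed.

(** Isolates the degenerate case in which a harmonic denominator [x + 2 * r] is zero and its inverse
    takes the default value 0. *)
Lemma add2r_eq0 (x : R) : 0 <= r -> 0 <= x -> x + 2 * r = 0 -> x = 0 /\ r = 0.
Proof. by move=> r0 x0 E; split; apply: le_anti; apply/andP; split; lra. Qed.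

(** The second form of the expectation; its single harmonic difference suits the induction. *)
Definition rLah_mean n k : R :=
  (k%:R + (k%:R * (n%:R + r) + r * (n%:R + 1)) * harmonic_diff (k%:R + 2 * r - 1) (n - k))
  / (n%:R - (k%:R - 1)).

(** The case [k = r = 0] is included because for [r = 0] the induction step for column 1 calls on
    column 0. *)
Lemma rLah_moment_closed n k : 0 <= r -> (k <= n)%N ->
  rLah_moment r n k = rLah r n k * rLah_mean n k.
Proof.
move=> r0; elim: n k => [|n IH] [|k] //.
- by move=> _; rewrite rLah_moment0n /rLah_mean /harmonic_diff big_geq // !(mulr0, add0r, mul0r).
- move=> _; rewrite rLah_momentS0 rLahS0 IH // /rLah_mean !subn0 harmonic_diff_recr.
  have [E|nz] := eqVneq (n%:R + 2 * r) 0.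
    by rewrite E (add2r_eq0 r0 (ler0n R n) E).2 !(mul0r, addr0).
  have n0 : 0 <= n%:R :> R by [].
  have pos : 0 < n%:R + 2 * r by rewrite lt_def nz addr_ge0 // mulr_ge0.
  rewrite -[n.+1%:R]natr1; move: (harmonic_diff _ _) (rLah _ _ _) => h L.
  by field; rewrite !lt0r_neq0 //; lra.
(* On the diagonal the column [n.+1] terms of row [n] vanish and all harmonic differences are
   empty. *)
rewrite ltnS leq_eqVlt => /predU1P[->|kn].
  rewrite rLah_momentSS rLahSS (rLah_moment_small _ (ltnSn n)) (rLah_small _ (ltnSn n)) IH //.
  rewrite /rLah_mean !subnn /harmonic_diff !big_geq // -!natr1.
  move: (rLah _ _ _) => L; field.
  by rewrite !lt0r_neq0 //; have := ler0n R n; lra.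
rewrite rLah_momentSS rLahSS !IH //; last exact: ltnW.
rewrite !rLah_closed -(subnSK kn) shifted_rising_recl /rLah_mean subSS -(subnSK kn).
have := mul_bin_left n k; rewrite -(subnSK kn).
move: (n - k.+1)%N (subnKC kn) => m mE.
move=> /(congr1 (fun x => x%:R : R)); rewrite !natrM -mE.
(* Column [k] starts its harmonic difference one term before column [k.+1]. Peeling off that first
   term, and the last term of the new row, expresses everything through one common difference
   [h]. *)
have aE : k.+1%:R + 2 * r - 1 = k%:R + 2 * r by rewrite -natr1; ring.
have bE : k%:R + 2 * r - 1 + 1 = k%:R + 2 * r by ring.
rewrite !aE harmonic_diff_recl !bE harmonic_diff_recr.
move: (harmonic_diff _ _) (shifted_rising _ _ _) ('C(_, _)%:R) ('C(_, _)%:R) => h p b c.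
rewrite -[m.+1%:R]natr1 -[(_ + _).+1%:R]natr1 natrD -[k.+1%:R]natr1.
have := ler0n R k; have := ler0n R m.
move: (k%:R) (m%:R) => x y y0 x0 E.
have nzy : y + 1 != 0 by rewrite lt0r_neq0 //; lra.
have nzx : x + 1 != 0 by rewrite lt0r_neq0 //; lra.
have -> : c = b * (y + 1) / (x + 1).
  by apply: (mulfI nzx); rewrite E; field.
(* If [k + 2r = 0], the peeled term is [0^-1 = 0] and the contribution of column [k] carries the
   factor [k + 2r]. *)
have [z|nz] := eqVneq (x + 2 * r) 0.
  have [xE rE] := add2r_eq0 r0 x0 z.
  rewrite z rE xE invr0; field.
  by rewrite !lt0r_neq0 //; lra.
have pos : 0 < x + 2 * r by rewrite lt_def nz addr_ge0 // mulr_ge0.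
field.
by rewrite !lt0r_neq0 //; lra.
Qed.

End Moment.

(** * Expectation of a finitely supported variable and the final formula *)

(** As the masses on [s] sum to 1, [X] is almost surely equal to the simple function [Y], which is
    integrated term by term. *)
Lemma expectation_finite_support (d : measure_display) (T : measurableType d)
    (R : realType) (P : probability T R) (X : {RV P >-> R}) (s : seq R) :
  uniq s -> (\sum_(x <- s) distribution P X [set x]%classic = 1)%E ->
  ('E_P[X] = \sum_(x <- s) x%:E * distribution P X [set x]%classic)%E.
Proof.
move=> us sum1; pose A (x : R) : set T := (X @^-1` [set x])%classic.
have mA x : measurable (A x).
  by rewrite /A -[X in measurable X]setTI; exact: measurable_funP.
pose Y (t : T) : \bar R := (\sum_(x <- s) x%:E * (\1_(A x) t)%:E)%E.
have iY x : P.-integrable [set: T] (fun t => x%:E * (\1_(A x) t)%:E)%E.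
  by apply: integrableZl => //; exact: integrable_indic.
have mY : measurable_fun [set: T] Y.
  by apply: emeasurable_sum => x; exact: measurable_int (iY x).
rewrite unlock (@ae_eq_integral _ _ _ P [set: T] Y) //.
- rewrite /Y (integral_sum _ iY) //; apply: eq_bigr => x _.
  rewrite integralZl //; last exact: integrable_indic.
  by rewrite integral_indic // setIT.
- exact/measurable_EFinP.
(* [U] is the event that [X] takes a value in [s]. It has probability 1, and on it exactly one
   indicator in [Y] is nonzero. *)
- pose U := (\bigcup_(x in [set` s]) A x)%classic.
  have mU : measurable U by apply: fin_bigcup_measurable.
  exists (~` U)%classic; split; first exact: measurableC.
    have PU : P U = 1%E.
      rewrite measure_fin_bigcup //; first last.
      - by move=> x y _ _ [t [<- <-]].
      - exact: finite_seq.
      by rewrite -sum1 -fsbig_seq.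
    by have := probability_setC P mU; rewrite PU subee.
  move=> t /=; apply: contra_not => -[x /= xs Xt] _.
  rewrite /Y (bigD1_seq x) //= big1 ?adde0 => [|y yx].
    by rewrite indicE mem_set // mule1 Xt.
  rewrite indicE memNset ?mule0 // /A /= => E.
  by move: yx; rewrite -E Xt eqxx.
Qed.

(* With alpha = k + 2r - 1:
   H_(n+2r) = H_(alpha + (n+1-k)) and H_(n+2r-1) = H_(alpha + (n-k)) *)
Theorem theorem3p1 (d : measure_display) (T : measurableType d)
    (R : realType) (P : probability T R) (X : {RV P >-> R})
    (n k : nat) (r : R)
    (hadm : admissible n k r) (hX : rLah_distributed X n k r) :
  ('E_P[X] =
    (k%:R * (n%:R + 2 * r) / (n%:R - (k%:R - 1))
       * harmonic_diff (k%:R + 2 * r - 1) (n.+1 - k)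
     + r * harmonic_diff (k%:R + 2 * r - 1) (n - k))%:E)%E
  /\
  k%:R * (n%:R + 2 * r) / (n%:R - (k%:R - 1))
     * harmonic_diff (k%:R + 2 * r - 1) (n.+1 - k)
   + r * harmonic_diff (k%:R + 2 * r - 1) (n - k)
  = (k%:R + (k%:R * (n%:R + r) + r * (n%:R + 1))
       * harmonic_diff (k%:R + 2 * r - 1) (n - k))
    / (n%:R - (k%:R - 1)).
Proof.
case: hadm => n0 kn r0; rewrite lt_max ltr0n => kr.
(* Admissibility gives [alpha > -1], which makes every harmonic denominator positive. *)
have kr0 : 0 < k%:R + 2 * r.
  by case/orP: kr => [k0|?]; [rewrite ltr_pwDl ?ltr0n ?mulr_ge0|rewrite ltr_wpDl ?mulr_gt0].
have kn' : k%:R <= n%:R :> R by rewrite ler_nat.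
have n0' : 0 < n%:R :> R by rewrite ltr0n.
set rhs := (X in _ /\ _ = X); set lhs := (X in _ /\ X = _).
(* The longer harmonic difference has the extra term [1 / (n + 2r)], which cancels the factor
   [n + 2r]; the coefficients of [h] agree since [k(n+2r) + r(n-k+1) = k(n+r) + r(n+1)]. *)
have lhsE : lhs = rhs.
  rewrite /lhs /rhs subSn // harmonic_diff_recr -[(n - k).+1%:R]natr1 natrB //.
  move: (harmonic_diff _ _) => h; field.
  by rewrite !lt0r_neq0 //; lra.
split=> //; rewrite -/lhs lhsE.
have L0 : rLah r n k != 0.
  rewrite lt0r_neq0 // rLah_closed mulr_gt0 ?ltr0n ?bin_gt0 //.
  by apply: prodr_gt0 => i _; rewrite ltr_wpDr.
pose s : seq R := [seq j%:R | j <- index_iota k n.+1].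
have us : uniq s by rewrite map_inj_uniq ?iota_uniq //; exact: mulrIn (oner_neq0 R).
have dist j : (k <= j < n.+1)%N -> distribution P X [set j%:R]%classic =
    ((rLah r n k)^-1 * (rstirling1 r n j * rstirling2 r j k))%:E.
  exact: hX.
rewrite (expectation_finite_support us) /s big_map big_nat.
  under eq_bigr do rewrite dist // -EFinM.
  rewrite -big_nat sumEFin; congr EFin.
  transitivity ((rLah r n k)^-1 * rLah_moment r n k); last first.
    by rewrite rLah_moment_closed // mulKf.
  rewrite mulr_sumr sum_nat_ord_widen => [|j jk]; last first.
    by rewrite rstirling2_small // !mulr0.
  by apply: eq_bigr => j _; ring.
(* The masses sum to 1 because [rLah] is by definition the sum of the unnormalised weights. *)
under eq_bigr do rewrite dist //.
by rewrite -big_nat sumEFin -mulr_sumr -/(rLah r n k) mulVf.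
Qed.
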